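(* Let $S=\{(d_0,q_0),\ldots,(d_M,q_M)\}$ be a regular alphabet--base system, with associated $\lambda,\Lambda$ and sequences $\alpha^j$ ($0\le j\le M-1$), $\gamma^j$ ($1\le j\le M$). An expansion $(j_i)$ of some number $x\in[\lambda,\Lambda]$ is unique (i.e. it is the only expansion of $x$) if and only if the following two conditions are satisfied for all $n\ge 1$: $j_{n+1}j_{n+2}\cdots\prec\alpha^{j_n}$ whenever $j_n<M$, and $j_{n+1}j_{n+2}\cdots\succ\gamma^{j_n}$ whenever $j_n>0$.
   Context: Let $M\ge 1$ be an integer. An alphabet--base system is a finite indexed family $S=\{(d_0,q_0),\ldots,(d_M,q_M)\}$ of pairs of real numbers with $q_0,\ldots,q_M>1$. A sequence is an element $(j_i)=j_1j_2\cdots$ of $\{0,\ldots,M\}^{\mathbb N}$, $\mathbb N=\{1,2,\ldots\}$. For a sequence put $\pi((j_i))=\sum_{i=1}^{\infty}\frac{d_{j_i}}{q_{j_1}\cdots q_{j_i}}$ (this series always converges). A sequence $(j_i)$ is an expansion of $x\in\mathbb R$ if $\pi((j_i))=x$. Write $j^\infty$ for the constant sequence $jj\cdots$, so $\pi(j^\infty)=\frac{d_j}{q_j-1}$, and set $\lambda:=\min_j\pi(j^\infty)$, $\Lambda:=\max_j\pi(j^\infty)$. $S$ is regular if $\frac{d_0+\lambda}{q_0}<\frac{d_1+\lambda}{q_1}<\cdots<\frac{d_M+\lambda}{q_M}$, $\frac{d_0+\Lambda}{q_0}<\frac{d_1+\Lambda}{q_1}<\cdots<\frac{d_M+\Lambda}{q_M}$,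 and $\frac{d_j+\Lambda}{q_j}\ge\frac{d_{j+1}+\lambda}{q_{j+1}}$ for all $j<M$. Sequences are ordered lexicographically: $(j_i)\prec(k_i)$ if there is an index $n$ with $j_i=k_i$ for all $i<n$ and $j_n<k_n$. A sequence is finite if it has a last nonzero element $j_n>0$, and infinite otherwise (so $0^\infty$ is infinite). A sequence is co-finite if it has a last element $j_n<M$, and co-infinite otherwise (so $M^\infty$ is co-infinite). For regular $S$ and $x\in[\lambda,\Lambda]$, $a(x)$ denotes the lexicographically largest infinite expansion of $x$ and $m(x)$ the lexicographically smallest co-infinite expansion of $x$ (both exist). Define $\alpha^j:=a\left(q_j\left(\frac{d_{j+1}+\lambda}{q_{j+1}}-\frac{d_j}{q_j}\right)\right)$ for $j=0,\ldots,M-1$, and $\gamma^j:=m\left(q_j\left(\frac{d_{j-1}+\Lambda}{q_{j-1}}-\frac{d_j}{q_j}\right)\right)$ for $j=1,\ldots,M$; the arguments lie in $[\lambda,\Lambda]$ when $S$ is regular. *)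

(* Defs.v *)
From HB Require Import structures.
From mathcomp Require Export all_boot all_order all_algebra.
From mathcomp Require Export all_classical all_reals all_analysis.

Set Implicit Arguments.
Unset Strict Implicit.
Unset Printing Implicit Defensive.

Import Order.TTheory GRing.Theory Num.Theory.
Import numFieldNormedType.Exports.

Local Open Scope classical_set_scope.
Local Open Scope ring_scope.

Record alphabet_base (R : realType) (M : nat) := AlphabetBase {
  digit : 'I_M.+1 -> R;
  base : 'I_M.+1 -> R;
  base_gt1 : forall j, 1 < base j
}.

(* Sequences are indexed from 0: [s i] is the term j_(i+1) of j_1 j_2 ... *)
Definition sequence (M : nat) := nat -> 'I_M.+1.

Section Sequences.
Variable M : nat.
Implicit Types s t : sequence M.

Definition tail_from (n : nat) s : sequence M := fun i => s (n + i)%N.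

Definition lex_lt s t : Prop :=
  exists n, (forall i, (i < n)%N -> s i = t i) /\ (s n < t n)%N.

Definition finite_sequence s : Prop :=
  exists n, (0 < s n)%N /\ (forall i, (n < i)%N -> s i = ord0).

Definition infinite_sequence s : Prop := ~ finite_sequence s.

Definition cofinite_sequence s : Prop :=
  exists n, (s n < M)%N /\ (forall i, (n < i)%N -> s i = ord_max).

Definition coinfinite_sequence s : Prop := ~ cofinite_sequence s.

End Sequences.

Section System.
Variables (R : realType) (M : nat) (S : alphabet_base R M).
Implicit Types (x : R) (s t : sequence M).

Definition value s : R :=
  limn (series (fun i => digit S (s i) / \prod_(k < i.+1) base S (s k))).

Definition expansion s x : Prop := value s = x.

Definition unique_expansion s x : Prop :=
  expansion s x /\ (forall t, expansion t x -> t = s).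

Definition constant_value (j : 'I_M.+1) : R := value (fun=> j).

(* The seed of each iterated operation is one of the values in its range, so
   these are the minimum and the maximum of [constant_value]. *)
Definition lambda_min : R :=
  \big[Num.min/constant_value ord0]_(j < M.+1) constant_value j.

Definition Lambda_max : R :=
  \big[Num.max/constant_value ord0]_(j < M.+1) constant_value j.

(* [inord k : 'I_M.+1] has value k when k <= M. *)
Definition regular : Prop :=
  [/\ forall j : 'I_M.+1, (j < M)%N ->
        (digit S j + lambda_min) / base S j <
        (digit S (inord j.+1) + lambda_min) / base S (inord j.+1),
      forall j : 'I_M.+1, (j < M)%N ->
        (digit S j + Lambda_max) / base S j <
        (digit S (inord j.+1) + Lambda_max) / base S (inord j.+1)
    & forall j : 'I_M.+1, (j < M)%N ->
        (digit S (inord j.+1) + lambda_min) / base S (inord j.+1) <=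
        (digit S j + Lambda_max) / base S j].

Definition largest_infinite_expansion x s : Prop :=
  [/\ infinite_sequence s, expansion s x
    & forall t, infinite_sequence t -> expansion t x -> t = s \/ lex_lt t s].

Definition smallest_coinfinite_expansion x s : Prop :=
  [/\ coinfinite_sequence s, expansion s x
    & forall t, coinfinite_sequence t -> expansion t x -> t = s \/ lex_lt s t].

(* The default value of [xget] is irrelevant when S is regular and x lies in
   [lambda_min, Lambda_max], since both expansions then exist. *)
Definition quasi_greedy x : sequence M :=
  xget (fun=> ord0) [set s | largest_infinite_expansion x s].

Definition quasi_lazy x : sequence M :=
  xget (fun=> ord0) [set s | smallest_coinfinite_expansion x s].

(* Meaningful only for j < M. *)
Definition alpha (j : 'I_M.+1) : sequence M :=
  quasi_greedy (base S j *
    ((digit S (inord j.+1) + lambda_min) / base S (inord j.+1)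
     - digit S j / base S j)).

(* Meaningful only for j > 0. *)
Definition gamma (j : 'I_M.+1) : sequence M :=
  quasi_lazy (base S j *
    ((digit S (inord j.-1) + Lambda_max) / base S (inord j.-1)
     - digit S j / base S j)).

End System.

(* Main.v *)
(* With the contractions step_j y = (d_j + y) / q_j, a sequence s satisfies
   value (tail_n s) = step_(s_n) (value (tail_(n+1) s)). By regularity the images
   of [lambda, Lambda] under consecutive steps overlap, so s is the only expansion
   of its value iff for every n, value (tail_n s) lies strictly below
   step_(s_n + 1) lambda and strictly above step_(s_n - 1) Lambda.
   Since step_j (value alpha^j) = step_(j+1) lambda, these are comparisons between
   the values of tail_(n+1) s and alpha^(s_n), gamma^(s_n). Under uniqueness the
   order of values implies the lexicographic order. Conversely, at the first
   difference between a tail and alpha^j, the infiniteness of alpha^j bounds the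
   excess of values by a contracted excess of a later tail, which therefore
   vanishes. *)
From mathcomp Require Import lra.
Require Import Defs.
Set Implicit Arguments.
Unset Strict Implicit.
Unset Printing Implicit Defensive.

Import Order.TTheory GRing.Theory Num.Theory.
Import numFieldNormedType.Exports.

Local Open Scope classical_set_scope.
Local Open Scope ring_scope.

(** * Lexicographic order and digit reversal *)

Section SequenceTheory.
Variable M : nat.
Implicit Types s t : sequence M.

Lemma tail_fromD m n s : tail_from m (tail_from n s) = tail_from (n + m) s.
Proof. by apply/funext => i; rewrite /tail_from addnA. Qed.

Lemma lex_total s t : s = t \/ lex_lt s t \/ lex_lt t s.
Proof.
have [st|] := pselect (forall i, s i = t i); first by left; apply/funext.
move/existsNP => [i /eqP ne_i]; right.
have ex : exists i, s i != t i by exists i.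
case: (ex_minnP ex) => n ne_n min_n.
have eq_lt k : (k < n)%N -> s k = t k.
  by move=> lt_kn; apply/eqP/negPn/negP => /min_n; rewrite leqNgt lt_kn.
case: (ltngtP (s n) (t n)) => [lt|lt|eq]; [left|right|].
- by exists n.
- by exists n; split=> // k /eq_lt.
- by move: ne_n; rewrite (val_inj eq) eqxx.
Qed.

Definition reverse_sequence s : sequence M := fun i => rev_ord (s i).

Lemma reverse_sequenceK : involutive reverse_sequence.
Proof. by move=> s; apply/funext => i; rewrite /reverse_sequence rev_ordK. Qed.

Lemma reverse_tail_from n s :
  reverse_sequence (tail_from n s) = tail_from n (reverse_sequence s).
Proof. by []. Qed.

Lemma ltn_rev_ord (i j : 'I_M.+1) : (rev_ord i < rev_ord j)%N = (j < i)%N.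
Proof. by rewrite /= !subSS ltn_sub2lE // -ltnS. Qed.

Lemma rev_ord_gt0 (i : 'I_M.+1) : (0 < rev_ord i)%N = (i < M)%N.
Proof. by rewrite /= subSS subn_gt0. Qed.

Lemma rev_ord_ltM (i : 'I_M.+1) : (rev_ord i < M)%N = (0 < i)%N.
Proof. by rewrite -rev_ord_gt0 rev_ordK. Qed.

Lemma rev_inordS (j : 'I_M.+1) :
  (j < M)%N -> rev_ord (inord j.+1 : 'I_M.+1) = inord (rev_ord j).-1.
Proof.
move=> jM; apply/val_inj => /=; rewrite !inordK ?subSS //.
  by rewrite subnS.
by rewrite ltnS (leq_trans (leq_pred _)) // leq_subr.
Qed.

Lemma rev_inord_pred (j : 'I_M.+1) :
  (0 < j)%N -> rev_ord (inord j.-1 : 'I_M.+1) = inord (rev_ord j).+1.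
Proof.
by move=> j0; rewrite -{1}[j]rev_ordK -rev_inordS ?rev_ordK ?rev_ord_ltM.
Qed.

Lemma lex_lt_reverse s t :
  lex_lt (reverse_sequence s) (reverse_sequence t) <-> lex_lt t s.
Proof.
split=> -[n [eq lt]]; exists n; split.
- by move=> i /eq /rev_ord_inj.
- by move: lt; rewrite ltn_rev_ord.
- by move=> i /eq st; rewrite /reverse_sequence st.
- by rewrite ltn_rev_ord.
Qed.

Lemma infinite_reverse s :
  infinite_sequence (reverse_sequence s) <-> coinfinite_sequence s.
Proof.
suff : finite_sequence (reverse_sequence s) <-> cofinite_sequence s.
  by rewrite /infinite_sequence /coinfinite_sequence => ->.
split=> -[n [ltn eq]]; exists n; split.
- by move: ltn; rewrite rev_ord_gt0.
- move=> i /eq e; rewrite -[s i]rev_ordK -/(reverse_sequence s i) e.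
  by apply/val_inj; rewrite /= subn1.
- by rewrite rev_ord_gt0.
- by move=> i /eq e; apply/val_inj; rewrite /= /reverse_sequence e /= subnn.
Qed.

End SequenceTheory.

(** * Values of sequences *)

Section SystemTheory.
Variables (R : realType) (M : nat).
Implicit Types (S : alphabet_base R M) (x y z : R) (s t : sequence M).
Implicit Types j : 'I_M.+1.

(** * Affine digit maps and their compositions *)

Definition step S j y := (digit S j + y) / base S j.

Definition unstep S j x := base S j * x - digit S j.

Lemma base_gt0 S j : 0 < base S j.
Proof. exact: lt_trans ltr01 (base_gt1 S j). Qed.

Lemma base_neq0 S j : base S j != 0.
Proof. by rewrite gt_eqF ?base_gt0. Qed.

Lemma unstepK S j : cancel (unstep S j) (step S j).
Proof. by move=> x; rewrite /step /unstep addrC subrK mulrC mulKf ?base_neq0. Qed.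

Lemma ler_step S j : {mono step S j : y z / y <= z}.
Proof.
by move=> y z; rewrite /step ler_pM2r ?invr_gt0 ?base_gt0// lerD2l.
Qed.

Lemma ltr_step S j : {mono step S j : y z / y < z}.
Proof. exact: leW_mono (ler_step S j). Qed.

Lemma step_inj S j : injective (step S j).
Proof. exact: inc_inj (ler_step S j). Qed.

Fixpoint prefix_step S n s y :=
  if n is m.+1 then step S (s 0) (prefix_step S m (tail_from 1 s) y) else y.

Definition terms S s : R^nat :=
  fun i => digit S (s i) / \prod_(k < i.+1) base S (s k).

(** The nested maps unfold into a partial sum of the series plus the seed [y] shrunk by the product
    of the bases. This ties the recursive form to the limit that defines [value]. *)
Lemma prefix_stepE S n s y :
  prefix_step S n s y = series (terms S s) n + y / \prod_(k < n) base S (s k).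
Proof.
elim: n s => [|n IHn] s /=; first by rewrite /series /= big_geq // big_ord0 divr1 add0r.
rewrite IHn /step /series /= big_nat_recl // {2}/terms big_ord1 !mulrDl -addrA.
congr (_ + _); congr (_ + _).
  rewrite mulr_suml; apply: eq_bigr => i _.
  by rewrite /terms [in RHS]big_ord_recl invfM [_^-1 * _]mulrC mulrA.
by rewrite [in RHS]big_ord_recl invfM [_^-1 * _]mulrC mulrA.
Qed.

Lemma prefix_stepS S n s y :
  prefix_step S n.+1 s y = prefix_step S n s (step S (s n) y).
Proof. by elim: n s => [|n IHn] s //; congr (step _ _ _); exact: IHn. Qed.

Lemma eq_prefix_step S n s t y :
  (forall i, (i < n)%N -> s i = t i) -> prefix_step S n s y = prefix_step S n t y.
Proof.
elim: n s t => [|n IHn] s t st //=; rewrite (st 0%N) //.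
by congr (step _ _ _); apply: IHn => i lt_in; apply: st.
Qed.

Lemma ler_prefix_step S n s : {mono prefix_step S n s : y z / y <= z}.
Proof. by elim: n s => [|n IHn] s y z //=; rewrite ler_step IHn. Qed.

Lemma prefix_stepB S n s y z :
  prefix_step S n s y - prefix_step S n s z
  = (y - z) / \prod_(k < n) base S (s k).
Proof. by rewrite !prefix_stepE mulrBl opprD addrACA subrr add0r. Qed.

Lemma prod_base_ge1 S n s : 1 <= \prod_(k < n) base S (s k).
Proof.
by elim/big_ind: _ => // [x y x1 y1|i _]; [exact: mulr_ege1|exact/ltW/base_gt1].
Qed.

(** The alphabet is finite, so even the largest inverse base stays below 1. *)
Lemma contraction_ratio S :
  exists r : R, [/\ 0 <= r, r < 1 & forall j, (base S j)^-1 <= r].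
Proof.
exists (\big[Num.max/0]_(j < M.+1) (base S j)^-1); split.
- exact: bigmax_ge_id.
- apply/bigmax_ltP; split=> [|j _]; first exact: ltr01.
  by rewrite invf_lt1 ?base_gt0 ?base_gt1.
- by move=> j; apply: le_bigmax.
Qed.

Lemma prefix_weight_cvg0 S s :
  (\prod_(k < n) base S (s k))^-1 @[n --> \oo] --> (0 : R).
Proof.
have [r [r0 r1 ler]] := contraction_ratio S.
apply: (@squeeze_cvgr _ _ _ _ (fun=> 0) (fun n => r ^+ n)).
- apply: nearW => n; apply/andP; split.
    by rewrite invr_ge0 (le_trans ler01) ?prod_base_ge1.
  elim: n s => [|n IHn] t; first by rewrite big_ord0 invr1.
  rewrite big_ord_recr /= invfM exprSr ler_pM ?invr_ge0 //.
    by rewrite (le_trans ler01) ?prod_base_ge1.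
  exact/ltW/base_gt0.
- exact: cvg_cst.
- by apply: cvg_expr; rewrite ger0_norm.
Qed.

Lemma weight_bounded_cvg0 S s (y : R^nat) (B : R) : (forall n, `|y n| <= B) ->
  y n / \prod_(k < n) base S (s k) @[n --> \oo] --> (0 : R).
Proof.
move=> leB; apply/norm_cvg0P.
apply: (@squeeze_cvgr _ _ _ _ (fun=> 0)
  (fun n => B * (\prod_(k < n) base S (s k))^-1)).
- apply: nearW => n; rewrite normr_ge0 /= normrM [`|_^-1|]ger0_norm.
    by rewrite ler_wpM2r // invr_ge0 (le_trans ler01) ?prod_base_ge1.
  by rewrite invr_ge0 (le_trans ler01) ?prod_base_ge1.
- exact: cvg_cst.
- rewrite -[X in _ --> X](mulr0 B); apply: cvgM; first exact: cvg_cst.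
  exact: prefix_weight_cvg0.
Qed.

(** * Fixed points of the digit maps and convergence of the series *)

Definition fixed_point S j := digit S j / (base S j - 1).

Lemma baseB1_gt0 S j : 0 < base S j - 1.
Proof. by rewrite subr_gt0 base_gt1. Qed.

(** The slope of the map lies strictly between 0 and 1, so every point is moved towards the fixed
    point. *)
Lemma le_step S j y : (y <= step S j y) = (y <= fixed_point S j).
Proof.
by rewrite ler_pdivlMr ?base_gt0// -lerBlDr -{2}[y]mulr1 -mulrBr
           ler_pdivlMr ?baseB1_gt0.
Qed.

Lemma step_le S j y : (step S j y <= y) = (fixed_point S j <= y).
Proof.
by rewrite ler_pdivrMr ?base_gt0// -lerBrDr -{2}[y]mulr1 -mulrBr
           ler_pdivrMr ?baseB1_gt0.
Qed.

Lemma step_fixed S j : step S j (fixed_point S j) = fixed_point S j.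
Proof. by apply/le_anti; rewrite le_step step_le lexx. Qed.

Lemma prefix_step_ge S n s y :
  (forall j, y <= fixed_point S j) -> y <= prefix_step S n s y.
Proof.
move=> ley; elim: n s => [|n IHn] s //=.
by rewrite (le_trans (_ : y <= step S (s 0) y)) ?le_step ?ler_step.
Qed.

Lemma prefix_step_le S n s y :
  (forall j, fixed_point S j <= y) -> prefix_step S n s y <= y.
Proof.
move=> ley; elim: n s => [|n IHn] s //=.
by rewrite (@le_trans _ _ (step S (s 0) y)) ?step_le ?ler_step.
Qed.

(** Seeded with [- B], a lower bound of all fixed points, the compositions are nondecreasing in
    their length and stay below the upper bound [B]. They differ from the partial sums by a null
    sequence. *)
Lemma terms_cvg S s : cvgn (series (terms S s)).
Proof.
pose B := \sum_(j < M.+1) `|fixed_point S j|.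
have leB j : `|fixed_point S j| <= B.
  by rewrite /B (bigD1 j) //= lerDl sumr_ge0.
have lo j : - B <= fixed_point S j by have := leB j; rewrite ler_norml => /andP[].
have hi j : fixed_point S j <= B by have := leB j; rewrite ler_norml => /andP[].
have BB : - B <= B by apply: le_trans (lo ord0) (hi ord0).
have cv1 : cvgn (fun n => prefix_step S n s (- B)).
  apply: nondecreasing_is_cvgn.
    apply/nondecreasing_seqP => n.
    by rewrite prefix_stepS ler_prefix_step le_step.
  exists B => _ [n _ <-].
  by apply: le_trans (prefix_step_le n s hi); rewrite ler_prefix_step.
have cv2 : cvgn (fun n => - B / \prod_(k < n) base S (s k)).
  apply: cvgP; apply: (@weight_bounded_cvg0 S s (fun=> - B) `|B|) => n.
  by rewrite normrN.
rewrite (_ : series _ = (fun n => prefix_step S n s (- B)) \-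
  (fun n => - B / \prod_(k < n) base S (s k))); first exact: is_cvgB.
by apply/funext => n /=; rewrite prefix_stepE addrK.
Qed.

(** The seed may vary with [n]: as long as it is bounded, the vanishing weight erases it in the
    limit. *)
Lemma prefix_step_cvg S s (y : R^nat) (B : R) : (forall n, `|y n| <= B) ->
  prefix_step S n s (y n) @[n --> \oo] --> value S s.
Proof.
move=> leB; under eq_fun do rewrite prefix_stepE.
rewrite -[value S s]addr0; apply: cvgD; first exact: terms_cvg.
exact: weight_bounded_cvg0 leB.
Qed.

(** With seed [y n] the composition of length [n] is constantly [y 0]. This turns any digit
    algorithm with bounded remainders into an expansion. *)
Lemma value_orbit S s (y : R^nat) (B : R) : (forall n, `|y n| <= B) ->
  (forall n, y n = step S (s n) (y n.+1)) -> value S s = y 0%N.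
Proof.
move=> leB yE; have /cvg_lim <- // := @prefix_step_cvg S s y B leB.
rewrite (_ : (fun n => _) = fun=> y 0%N) ?lim_cst//.
by apply/funext; elim=> // n IHn; rewrite prefix_stepS -yE.
Qed.

Lemma value_step S s : value S s = step S (s 0%N) (value S (tail_from 1 s)).
Proof.
have cv : (fun n => prefix_step S n (tail_from 1 s) 0) @ \oo
    --> value S (tail_from 1 s).
  by apply: (@prefix_step_cvg S _ (fun=> 0) 0) => n; rewrite normr0.
have cvs : (fun n => prefix_step S n.+1 s 0) @ \oo --> value S s.
  rewrite (@cvg_shiftS _ (fun n => prefix_step S n s 0)).
  by apply: (@prefix_step_cvg S _ (fun=> 0) 0) => n; rewrite normr0.
have /cvg_lim <- // := cvs; apply: cvg_lim => //=.
apply: cvgM; last exact: cvg_cst.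
by apply: cvgD; [exact: cvg_cst|exact: cv].
Qed.

Lemma value_tail_step S n s :
  value S (tail_from n s) = step S (s n) (value S (tail_from n.+1 s)).
Proof. by rewrite value_step tail_fromD addn1 /tail_from addn0. Qed.

Lemma value_prefix S n s : value S s = prefix_step S n s (value S (tail_from n s)).
Proof.
elim: n => [|n IHn]; first by congr (value _ _); apply/funext.
by rewrite prefix_stepS -value_tail_step.
Qed.

Lemma value_cat S n s t : (forall i, (i < n)%N -> t i = s i) ->
  value S t = prefix_step S n s (step S (t n) (value S (tail_from n.+1 t))).
Proof.
by move=> ts; rewrite (value_prefix S n) (eq_prefix_step S _ ts) value_tail_step.
Qed.

Lemma ler_value_tail S n s t : (forall i, (i < n)%N -> s i = t i) ->
  (value S s <= value S t) = (value S (tail_from n s) <= value S (tail_from n t)).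
Proof.
move=> st; rewrite (value_prefix S n s) (value_prefix S n t).
by rewrite (eq_prefix_step S _ st) ler_prefix_step.
Qed.

(** * Extremal values of the system *)

Lemma constant_valueE S j : constant_value S j = fixed_point S j.
Proof.
apply: (@value_orbit S _ (fun=> fixed_point S j) `|fixed_point S j|) => // n.
by rewrite step_fixed.
Qed.

Lemma lambda_min_le S j : lambda_min S <= fixed_point S j.
Proof. by rewrite -constant_valueE; apply: bigmin_le_cond. Qed.

Lemma le_Lambda_max S j : fixed_point S j <= Lambda_max S.
Proof. by rewrite -constant_valueE; apply: le_bigmax. Qed.

Lemma lambda_minP S : exists j, lambda_min S = fixed_point S j.
Proof.
rewrite /lambda_min; elim/big_ind: _ => [|x y [i ->] [j ->]|j _].
- by exists ord0; rewrite constant_valueE.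
- by case: (leP (fixed_point S i) (fixed_point S j)) => _; [exists i|exists j].
- by exists j; rewrite constant_valueE.
Qed.

Lemma Lambda_maxP S : exists j, Lambda_max S = fixed_point S j.
Proof.
rewrite /Lambda_max; elim/big_ind: _ => [|x y [i ->] [j ->]|j _].
- by exists ord0; rewrite constant_valueE.
- by case: (leP (fixed_point S i) (fixed_point S j)) => _; [exists j|exists i].
- by exists j; rewrite constant_valueE.
Qed.

(** Seeded with [lambda_min S], which is below every fixed point, all compositions stay above it,
    hence so does their limit. The upper bound is symmetric. *)
Lemma value_bounds S s : lambda_min S <= value S s <= Lambda_max S.
Proof.
have cv y := @prefix_step_cvg S s (fun=> y) `|y| (fun=> lexx _).
apply/andP; split.
- apply: cvgr_to_ge (cv (lambda_min S)) _; apply: nearW => n.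
  by apply: prefix_step_ge => j; apply: lambda_min_le.
- apply: cvgr_to_le (cv (Lambda_max S)) _; apply: nearW => n.
  by apply: prefix_step_le => j; apply: le_Lambda_max.
Qed.

Lemma lambda_step S j : lambda_min S <= step S j (lambda_min S).
Proof. by rewrite le_step lambda_min_le. Qed.

(* Conjugating the system by [x |-> - x] and reversing the alphabet exchanges
   [alpha] and [gamma], so each one-sided statement yields its mirror image. *)
Definition dual S : alphabet_base R M :=
  @AlphabetBase R M (fun j => - digit S (rev_ord j)) (fun j => base S (rev_ord j))
    (fun j => base_gt1 S (rev_ord j)).

Lemma step_dual S j y : step (dual S) j y = - step S (rev_ord j) (- y).
Proof. by rewrite /step /= -mulNr opprD opprK. Qed.

Lemma value_dual S s : value (dual S) (reverse_sequence s) = - value S s.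
Proof.
rewrite /value -limN; last exact: terms_cvg.
rewrite -seriesN; congr (limn (series _)); apply/funext => i /=.
rewrite /reverse_sequence rev_ordK mulNr; congr (- (_ / _)).
by apply: eq_bigr => k _; rewrite rev_ordK.
Qed.

Lemma fixed_point_dual S j : fixed_point (dual S) j = - fixed_point S (rev_ord j).
Proof. by rewrite /fixed_point mulNr. Qed.

Lemma lambda_min_dual S : lambda_min (dual S) = - Lambda_max S.
Proof.
apply/le_anti/andP; split.
- have [j ->] := Lambda_maxP S.
  by rewrite -[j]rev_ordK -fixed_point_dual lambda_min_le.
- have [j ->] := lambda_minP (dual S).
  by rewrite fixed_point_dual lerN2 le_Lambda_max.
Qed.

Lemma Lambda_max_dual S : Lambda_max (dual S) = - lambda_min S.
Proof.
apply/le_anti/andP; split.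
- have [j ->] := Lambda_maxP (dual S).
  by rewrite fixed_point_dual lerN2 lambda_min_le.
- have [j ->] := lambda_minP S.
  by rewrite -[j]rev_ordK -fixed_point_dual le_Lambda_max.
Qed.

(** Reversal sends a digit and its successor to a digit and its predecessor. The two monotonicity
    conditions are exchanged and the overlap condition is preserved. *)
Lemma regular_dual S : regular S -> regular (dual S).
Proof.
have aux j : (j < M)%N -> let k : 'I_M.+1 := rev_ord (inord j.+1) in
    (k < M)%N /\ rev_ord j = inord k.+1.
  move=> jM k; rewrite /k rev_ord_ltM inordK //; split=> //.
  by rewrite -rev_inord_pred inordK //= inord_val.
move=> [lo hi overlap]; split=> j /aux /= [kM jE];
  rewrite -!/(step (dual S) _ _) !step_dual ?lambda_min_dual ?Lambda_max_dual;
  rewrite !opprK jE ?ltrN2 ?lerN2.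
- exact: hi.
- exact: lo.
- exact: (overlap (rev_ord _) kM).
Qed.

End SystemTheory.

(** * Regular systems: digit 0 and the minimal value *)

Section RegularTheory.
Variables (R : realType) (M : nat) (S : alphabet_base R M).
Hypothesis S_regular : regular S.
Implicit Types (x y z : R) (s t : sequence M) (j k : 'I_M.+1).

Local Notation lo := (lambda_min S).
Local Notation hi := (Lambda_max S).
Local Notation step := (step S).
Local Notation value := (value S).

Lemma step_lambda_incr j k : (j < k)%N -> step j lo < step k lo.
Proof.
have [incr _ _] := S_regular; case: k => k k_lt /=.
elim: k k_lt => // k IHk k_lt; rewrite ltnS leq_eqVlt => jk.
have kM : (k < M)%N by [].
have {}incr : step (Ordinal (ltnW k_lt)) lo < step (Ordinal k_lt) lo.
  rewrite (_ : Ordinal k_lt = inord k.+1); first exact: incr.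
  by apply/val_inj; rewrite /= inordK.
have [/eqP jk'|jk'] := orP jk; last exact: lt_trans (IHk _ jk') incr.
by rewrite (_ : j = Ordinal (ltnW k_lt)) //; apply/val_inj.
Qed.

Lemma step_lambda_mono j k : (j <= k)%N -> step j lo <= step k lo.
Proof.
by rewrite leq_eqVlt => /orP[/eqP/val_inj ->//|/step_lambda_incr/ltW].
Qed.

(** The minimum is fixed by some digit map, and at that point the map of digit 0 takes the least
    value among all digits. On the other hand no digit map moves the minimum down. *)
Lemma step0_lambda : step ord0 lo = lo.
Proof.
have [j loE] := lambda_minP S.
apply/le_anti; rewrite lambda_step andbT {2}loE -step_fixed -loE.
exact: step_lambda_mono.
Qed.

Lemma value_constant0 : value (fun=> ord0) = lo.
Proof.
apply: (@value_orbit _ _ S _ (fun=> lo) `|lo|) => // n.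
by rewrite step0_lambda.
Qed.

(** A positive first digit would lift the value strictly above [step ord0 lo], which is [lo]. So the
    first digit is 0, and injectivity of [step] passes the equality on to the next tail. *)
Lemma value_eq_lambda s : value s = lo -> forall i, s i = ord0.
Proof.
move=> vs; have zero n : value (tail_from n s) = lo -> s n = ord0.
  rewrite value_tail_step => vn; apply/val_inj/eqP.
  rewrite /= -leqn0 leqNgt; apply/negP => s0.
  have := step_lambda_incr (j := ord0) s0; rewrite step0_lambda ltNge -{2}vn.
  by rewrite ler_step; have /andP[->] := value_bounds S (tail_from n.+1 s).
suff tail_lo n : value (tail_from n s) = lo by move=> i; apply: zero.
elim: n => [|n vn]; first by rewrite -[RHS]vs; congr (Defs.value _ _); apply/funext.
apply: (@step_inj _ _ S (s n)).
by rewrite -value_tail_step vn (zero _ vn) step0_lambda.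
Qed.

(** Source of strictness for infinite sequences: a tail of value [lo] consists of zeros, which would
    make [n] the last nonzero position. *)
Lemma infinite_value_tail s n :
  infinite_sequence s -> (0 < s n)%N -> lo < value (tail_from n.+1 s).
Proof.
move=> inf s0; rewrite lt_neqAle; have /andP[-> _] := value_bounds S (tail_from n.+1 s).
rewrite andbT eq_sym; apply/eqP => /value_eq_lambda tail0; apply: inf; exists n.
by split=> // i lt_ni; have := tail0 (i - n.+1)%N; rewrite /tail_from subnKC.
Qed.

End RegularTheory.

(** * Quasi-greedy expansions and uniqueness *)

Section Uniqueness.
Variables (R : realType) (M : nat).
Implicit Types (S : alphabet_base R M) (x y z : R) (s t : sequence M).
Implicit Types j k : 'I_M.+1.

Lemma stepM_Lambda S : regular S -> step S ord_max (Lambda_max S) = Lambda_max S.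
Proof.
move=> /regular_dual/step0_lambda; rewrite step_dual lambda_min_dual opprK.
move=> /oppr_inj; rewrite (_ : rev_ord _ = ord_max) //.
by apply/val_inj; rewrite /= subn1.
Qed.

(** * The greedy algorithm and largest infinite expansions *)

Section QuasiGreedy.
Variable S : alphabet_base R M.
Hypothesis S_regular : regular S.

(** The strict inequality makes the algorithm quasi-greedy: remainders stay strictly above the
    minimum, which rules out a tail of zeros. For regular [S] the default [ord0] is itself
    admissible as soon as [x] exceeds the minimum. *)
Definition greedy_digit x : 'I_M.+1 :=
  [arg max_(j > ord0 | (step S j (lambda_min S) < x)%R) (j : nat)]%N.

Definition greedy_orbit x n := iter n (fun y => unstep S (greedy_digit y) y) x.

Definition greedy_sequence x : sequence M :=
  fun n => greedy_digit (greedy_orbit x n).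

Lemma greedy_digitP x : lambda_min S < x ->
  step S (greedy_digit x) (lambda_min S) < x /\
  forall j, step S j (lambda_min S) < x -> (j <= greedy_digit x)%N.
Proof.
move=> lo_x; rewrite /greedy_digit.
by case: arg_maxnP => [|j]; first by rewrite step0_lambda.
Qed.

(** The lower bound is the admissibility of the chosen digit. For the upper bound, maximality puts
    [x] at or below the image of the minimum under the next digit, and the overlap condition
    applies; for the last digit, the maximum is a fixed point. *)
Lemma greedy_unstep x : lambda_min S < x <= Lambda_max S ->
  lambda_min S < unstep S (greedy_digit x) x <= Lambda_max S.
Proof.
move=> /andP[lo_x x_hi]; have [lt_x max_x] := greedy_digitP lo_x.
rewrite -(ltr_step S (greedy_digit x)) -(ler_step S (greedy_digit x)) unstepK lt_x /=.
have [ltM|geM] := ltnP (greedy_digit x) M; last first.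
  rewrite (_ : greedy_digit x = ord_max) ?stepM_Lambda //.
  by apply/val_inj/eqP; rewrite eqn_leq geM -ltnS ltn_ord.
have [_ _ /(_ _ ltM)] := S_regular; apply: le_trans; rewrite leNgt.
by apply/negP => /max_x; rewrite inordK // ltnn.
Qed.

Lemma greedy_orbit_bounds x n : lambda_min S < x <= Lambda_max S ->
  lambda_min S < greedy_orbit x n <= Lambda_max S.
Proof. by move=> x_in; elim: n => //= n; apply: greedy_unstep. Qed.

Lemma value_greedy x : lambda_min S < x <= Lambda_max S ->
  value S (greedy_sequence x) = x.
Proof.
move=> x_in.
apply: (@value_orbit _ _ S _ (greedy_orbit x) (`|lambda_min S| + `|Lambda_max S|)).
  move=> n; have /andP[] := greedy_orbit_bounds n x_in.
  have := ler_norm (- lambda_min S); have := ler_norm (Lambda_max S).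
  have := normr_ge0 (lambda_min S); have := normr_ge0 (Lambda_max S).
  by rewrite normrN ler_norml => *; apply/andP; split; lra.
by move=> n; rewrite unstepK.
Qed.

Lemma tail_greedy x n :
  tail_from n (greedy_sequence x) = greedy_sequence (greedy_orbit x n).
Proof.
by apply/funext => i; rewrite /tail_from /greedy_sequence /greedy_orbit addnC iterD.
Qed.

Lemma greedy_infinite x : lambda_min S < x <= Lambda_max S ->
  infinite_sequence (greedy_sequence x).
Proof.
move=> x_in [n [_ tail0]].
have /andP[] := greedy_orbit_bounds n.+1 x_in.
rewrite -{1}(value_greedy (greedy_orbit_bounds n.+1 x_in)) -tail_greedy.
rewrite (_ : tail_from _ _ = fun=> ord0) ?value_constant0 ?ltxx//.
by apply/funext => i; rewrite /tail_from tail0 // leq_addr.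
Qed.

(** Up to the first difference with the greedy sequence, [t] leaves the same remainder. A larger
    digit of [t] there is positive, so infiniteness of [t] makes it admissible, against the
    maximality of the greedy digit. *)
Lemma exists_largest_infinite x : lambda_min S < x <= Lambda_max S ->
  exists s, largest_infinite_expansion S x s.
Proof.
move=> x_in; exists (greedy_sequence x); split.
- exact: greedy_infinite.
- exact: value_greedy.
move=> t t_inf t_x; have [->|[|[n [eq_lt lt_n]]]] := lex_total t (greedy_sequence x);
  [by left|by right|].
have orb := greedy_orbit_bounds n x_in; have /andP[lo_n _] := orb.
have tn : value S (tail_from n t) = greedy_orbit x n.
  rewrite -[RHS](value_greedy orb) -tail_greedy; apply/le_anti.
  rewrite -!ler_value_tail // => [|i /eq_lt //].
  by rewrite t_x value_greedy // lexx.
suff : (t n <= greedy_sequence x n)%N by rewrite leqNgt lt_n.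
have [_ ->] // := greedy_digitP lo_n; rewrite -[X in _ < X]tn value_tail_step.
rewrite ltr_step infinite_value_tail //.
exact: leq_ltn_trans lt_n.
Qed.

Lemma exists_expansion x : lambda_min S <= x <= Lambda_max S ->
  exists s, expansion S s x.
Proof.
case/andP; rewrite le_eqVlt => /orP[/eqP <- _|lo_x x_hi].
  by exists (fun=> ord0); apply: value_constant0.
by exists (greedy_sequence x); apply: value_greedy; rewrite lo_x.
Qed.

(** Monotonicity and overlap place the argument of [quasi_greedy] in the half-open interval where
    the expansion exists, so [xget] does not return its default. *)
Lemma alphaP j : (j < M)%N ->
  infinite_sequence (alpha S j) /\
  step S j (value S (alpha S j)) = step S (inord j.+1) (lambda_min S).
Proof.
move=> jM; pose x := unstep S j (step S (inord j.+1) (lambda_min S)).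
have -> : alpha S j = quasi_greedy S x.
  by rewrite /alpha mulrBr [_ * (_ / base S j)]mulrCA divff ?base_neq0 ?mulr1.
have x_in : lambda_min S < x <= Lambda_max S.
  have [incr _ overlap] := S_regular.
  by rewrite -(ltr_step S j) -(ler_step S j) unstepK incr ?overlap.
have [inf val_x _] := xgetPex (fun=> ord0) (exists_largest_infinite x_in).
by split=> //; rewrite [value S _]val_x unstepK.
Qed.

End QuasiGreedy.

(** * Quasi-lazy expansions by duality *)

Lemma smallest_coinfinite_dual S x s :
  largest_infinite_expansion (dual S) (- x) (reverse_sequence s) ->
  smallest_coinfinite_expansion S x s.
Proof.
move=> [inf val_s max_s]; split.
- exact/infinite_reverse.
- by apply: oppr_inj; rewrite -value_dual.
move=> t /infinite_reverse t_inf t_x.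
have [|eq|lt] := max_s _ t_inf.
- by rewrite /expansion value_dual t_x.
- by left; rewrite -[t]reverse_sequenceK eq reverse_sequenceK.
- by right; apply/lex_lt_reverse.
Qed.

Lemma exists_smallest_coinfinite S x : regular S ->
  lambda_min S <= x < Lambda_max S ->
  exists s, smallest_coinfinite_expansion S x s.
Proof.
move=> /regular_dual reg x_in.
have [|s] := exists_largest_infinite reg (x := - x).
  by rewrite lambda_min_dual Lambda_max_dual ltrN2 lerN2 andbC.
rewrite -[s]reverse_sequenceK => /smallest_coinfinite_dual s_x.
by exists (reverse_sequence s).
Qed.

Lemma gammaP S j : regular S -> (0 < j)%N ->
  coinfinite_sequence (gamma S j) /\
  step S j (value S (gamma S j)) = step S (inord j.-1) (Lambda_max S).
Proof.
move=> S_regular j0; pose x := unstep S j (step S (inord j.-1) (Lambda_max S)).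
have -> : gamma S j = quasi_lazy S x.
  by rewrite /gamma mulrBr [_ * (_ / base S j)]mulrCA divff ?base_neq0 ?mulr1.
(* Regularity is stated for a digit and its successor. It is applied to the predecessor of [j],
   whose successor must be identified with [j]. *)
have predK : (inord j.-1 : 'I_M.+1) = j.-1 :> nat.
  by rewrite inordK // (leq_ltn_trans (leq_pred _)).
have kM : ((inord j.-1 : 'I_M.+1) < M)%N by rewrite predK prednK // -ltnS.
have kS : inord (inord j.-1 : 'I_M.+1).+1 = j by rewrite predK prednK // inord_val.
have x_in : lambda_min S <= x < Lambda_max S.
  have [_ incr overlap] := S_regular.
  have := incr _ kM; have := overlap _ kM; rewrite kS => le_x lt_x.
  by rewrite -(ltr_step S j) -(ler_step S j) unstepK; apply/andP.
have [inf val_x _] := xgetPex (fun=> ord0) (exists_smallest_coinfinite S_regular x_in).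
by split=> //; rewrite [value S _]val_x unstepK.
Qed.

(** * Uniqueness in terms of values *)

Definition below_next S s : Prop := forall n, (s n < M)%N ->
  step S (s n) (value S (tail_from n.+1 s)) < step S (inord (s n).+1) (lambda_min S).

Definition above_prev S s : Prop := forall n, (0 < s n)%N ->
  step S (inord (s n).-1) (Lambda_max S) < step S (s n) (value S (tail_from n.+1 s)).

Lemma below_next_dual S s :
  below_next (dual S) (reverse_sequence s) <-> above_prev S s.
Proof.
split=> H n sn.
- have := H n; rewrite /reverse_sequence rev_ord_ltM => /(_ sn).
  rewrite -rev_inord_pred // -/(reverse_sequence _) -reverse_tail_from value_dual.
  by rewrite lambda_min_dual !step_dual !rev_ordK !opprK ltrN2.
- move: sn; rewrite /reverse_sequence rev_ord_ltM => sn.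
  rewrite -rev_inord_pred // -/(reverse_sequence _) -reverse_tail_from value_dual.
  by rewrite lambda_min_dual !step_dual !rev_ordK !opprK ltrN2 H.
Qed.

(** At the first difference the remaining value of [s] is below the image of the minimum under the
    next digit, while that of [t], whose digit is at least this next one, is not. *)
Lemma below_next_lex S s t : regular S -> below_next S s -> lex_lt s t ->
  value S s < value S t.
Proof.
move=> S_regular below [n [eq_lt lt_n]]; rewrite ltNge.
rewrite (ler_value_tail S (n := n)) => [|i /eq_lt //]; rewrite -ltNge.
have sM : (s n < M)%N by rewrite (leq_trans lt_n) // -ltnS.
rewrite value_tail_step (lt_le_trans (below _ sM)) //.
rewrite value_tail_step (@le_trans _ _ (step S (t n) (lambda_min S))) //.
  by apply: step_lambda_mono; rewrite ?inordK.
by rewrite ler_step; have /andP[] := value_bounds S (tail_from n.+1 t).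
Qed.

Lemma above_prev_lex S s t : regular S -> above_prev S s -> lex_lt t s ->
  value S t < value S s.
Proof.
move=> /regular_dual reg /below_next_dual below /lex_lt_reverse lt_ts.
by have := below_next_lex reg below lt_ts; rewrite !value_dual ltrN2.
Qed.

(** If the bound fails at [n], the remaining value [y] also lies in the image of the next digit [k].
    Replacing the digit by [k] and expanding the new remainder gives a second expansion [u]. *)
Lemma unique_below_next S s : regular S ->
  (forall t, value S t = value S s -> t = s) -> below_next S s.
Proof.
move=> S_regular uniq n sM; rewrite ltNge; apply/negP => le_v.
set k := inord (s n).+1 in le_v; set y := step S (s n) _ in le_v.
have [t t_y] : exists t, expansion S t (unstep S k y).
  apply: exists_expansion => //.
  apply/andP; split; rewrite -(ler_step S k) unstepK //.
  (* Upper bound: [y] is at most the image of the maximum under digit [s n], which is smaller than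
     its image under [k]. *)
  have [_ /(_ _ sM)/ltW + _] := S_regular; apply: le_trans.
  by rewrite ler_step; have /andP[] := value_bounds S (tail_from n.+1 s).
pose u : sequence M := fun i =>
  if (i < n)%N then s i else if i == n then k else t (i - n.+1)%N.
have un : u n = k by rewrite /u ltnn eqxx.
have : u = s.
  apply: uniq; rewrite (@value_cat _ _ _ n s) => [|i]; last by rewrite /u => ->.
  rewrite un (_ : tail_from n.+1 u = t).
    by rewrite [value S t]t_y unstepK /y -value_tail_step -value_prefix.
  apply/funext => i; rewrite /tail_from /u addKn.
  by rewrite ltnNge gtn_eqF ?ltn_addr //= (leq_trans (leqnSn n)) ?leq_addr.
move=> us; have := congr1 (fun v : sequence M => v n : nat) us.
by rewrite /= un inordK // => /eqP; rewrite gtn_eqF.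
Qed.

Lemma unique_above_prev S s : regular S ->
  (forall t, value S t = value S s -> t = s) -> above_prev S s.
Proof.
move=> /regular_dual reg uniq; apply/below_next_dual.
apply: unique_below_next => // t; rewrite -[t]reverse_sequenceK !value_dual.
by move=> /oppr_inj/uniq ->.
Qed.

(** The family [a] is left abstract so that the mirror image can use reversed [gamma] sequences
    without identifying them with [alpha] of the dual system. *)
Lemma lex_below_next S s (a : 'I_M.+1 -> sequence M) : regular S ->
  (forall j, (j < M)%N -> infinite_sequence (a j) /\
     step S j (value S (a j)) = step S (inord j.+1) (lambda_min S)) ->
  (forall n, (s n < M)%N -> lex_lt (tail_from n.+1 s) (a (s n))) ->
  below_next S s.
Proof.
move=> S_regular aP lex_s; have [r [r0 r1 le_r]] := contraction_ratio S.
(* If the value of a tail never exceeds that of its bounding sequence [a] by more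
   than [C], it never exceeds it by [C * r]; iterating forces the excess to 0. *)
have improve (C : R) : 0 <= C ->
    (forall n, (s n < M)%N ->
       value S (tail_from n.+1 s) <= value S (a (s n)) + C) ->
    forall n, (s n < M)%N ->
       value S (tail_from n.+1 s) < value S (a (s n)) + C * r.
  move=> C0 leC n sM; have [m] := lex_s n sM.
  have [inf_a _] := aP _ sM; move: (a (s n)) inf_a => t inf_t [eq_lt lt_m].
  set u := tail_from n.+1 s in eq_lt lt_m *.
  have uM : (u m < M)%N by rewrite (leq_trans lt_m) // -ltnS.
  have t0 : (0 < t m)%N by apply: leq_ltn_trans lt_m.
  have [_ aE] := aP _ uM.
  (* The digit [t m] is at least the successor of [u m], and it is positive, so infiniteness of [t]
     makes the inequality strict. *)
  have lt_t : step S (u m) (value S (a (u m))) < value S (tail_from m t).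
    rewrite aE value_tail_step (@le_lt_trans _ _ (step S (t m) (lambda_min S))) //.
      by apply: step_lambda_mono; rewrite ?inordK.
    by rewrite ltr_step infinite_value_tail.
  (* Both values start with the digit [u m], so their difference is the excess of the later tail at
     [n.+1 + m], divided by one base. *)
  have le_u : value S (tail_from m u) - step S (u m) (value S (a (u m))) <= C * r.
    rewrite value_tail_step /step -mulrBl opprD addrACA subrr add0r.
    apply: le_trans (_ : C / base S (u m) <= _); last by rewrite ler_wpM2l.
    rewrite ler_wpM2r ?invr_ge0 ?(ltW (base_gt0 _ _)) // lerBlDl.
    by have := leC (n.+1 + m)%N uM; rewrite /u tail_fromD addnS.
  rewrite -ltrBlDl (value_prefix S m u) (value_prefix S m t).
  rewrite (eq_prefix_step S _ eq_lt) prefix_stepB.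
  (* The common prefix of length [m] can only shrink the difference further, its weight being at
     least 1; [m] may be 0, so the factor [r] comes from [le_u] alone. *)
  have w1 := prod_base_ge1 S m t; have w0 := lt_le_trans ltr01 w1.
  have lt_w : value S (tail_from m u) - value S (tail_from m t) < C * r by lra.
  rewrite ltr_pdivrMr // (lt_le_trans lt_w) //.
  by rewrite ler_peMr ?mulr_ge0.
have geometric (k n : nat) : (s n < M)%N -> value S (tail_from n.+1 s)
    <= value S (a (s n)) + (Lambda_max S - lambda_min S) * r ^+ k.
  elim: k n => [|k IHk] n sM.
    have /andP[_ hi_s] := value_bounds S (tail_from n.+1 s).
    have /andP[lo_a _] := value_bounds S (a (s n)).
    by rewrite expr0; lra.
  rewrite exprSr mulrA; apply/ltW/improve => //.
  rewrite mulr_ge0 ?exprn_ge0 // subr_ge0.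
  by have /andP[] := value_bounds S s; apply: le_trans.
(* The limit yields only a weak inequality. Feeding zero excess to [improve] once more makes it
   strict. *)
have le_a n : (s n < M)%N -> value S (tail_from n.+1 s) <= value S (a (s n)) + 0.
  move=> sM; rewrite -[0](mulr0 (Lambda_max S - lambda_min S)).
  have cv : (fun k : nat => value S (a (s n)) + (Lambda_max S - lambda_min S) * r ^+ k)
      @ \oo --> value S (a (s n)) + (Lambda_max S - lambda_min S) * 0.
    apply: cvgD; first exact: cvg_cst.
    apply: cvgM; first exact: cvg_cst.
    by apply: cvg_expr; rewrite ger0_norm.
  by apply: cvgr_to_ge cv _; apply: nearW => k; apply: geometric.
move=> n sM; have [_ <-] := aP _ sM; rewrite ltr_step.
by have := improve 0 (lexx _) le_a n sM; rewrite mul0r addr0.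
Qed.

Lemma lex_above_prev S s (c : 'I_M.+1 -> sequence M) : regular S ->
  (forall j, (0 < j)%N -> coinfinite_sequence (c j) /\
     step S j (value S (c j)) = step S (inord j.-1) (Lambda_max S)) ->
  (forall n, (0 < s n)%N -> lex_lt (c (s n)) (tail_from n.+1 s)) ->
  above_prev S s.
Proof.
move=> /regular_dual reg cP lex_s; apply/below_next_dual.
apply: (@lex_below_next _ _ (fun j => reverse_sequence (c (rev_ord j)))) => //.
- move=> j; rewrite -rev_ord_gt0 => j0; have [coinf cE] := cP _ j0.
  split; first exact/infinite_reverse.
  rewrite !step_dual value_dual lambda_min_dual !opprK cE.
  by rewrite rev_inordS // -rev_ord_gt0.
- move=> n; rewrite /reverse_sequence rev_ord_ltM rev_ordK => sn.
  exact/lex_lt_reverse/lex_s.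
Qed.

End Uniqueness.

Theorem corollary1p3 (R : realType) (M : nat) (M_ge1 : (1 <= M)%N)
    (S : alphabet_base R M) (S_regular : regular S)
    (x : R) (x_in : lambda_min S <= x <= Lambda_max S)
    (s : sequence M) (s_x : expansion S s x) :
  unique_expansion S s x <->
  (forall n : nat,
     ((s n < M)%N -> lex_lt (tail_from n.+1 s) (alpha S (s n))) /\
     ((0 < s n)%N -> lex_lt (gamma S (s n)) (tail_from n.+1 s))).
Proof.
split=> [[_ uniq]|lex_s].
- have {}uniq t : value S t = value S s -> t = s.
    by move=> ts; apply: uniq; rewrite /expansion ts.
  have below := unique_below_next S_regular uniq.
  have above := unique_above_prev S_regular uniq.
  have below_tail n : below_next S (tail_from n s).
    by move=> i; rewrite tail_fromD addnS; apply: below.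
  have above_tail n : above_prev S (tail_from n s).
    by move=> i; rewrite tail_fromD addnS; apply: above.
  move=> n; split=> sn.
  + have [_ aE] := alphaP S_regular sn.
    have lt_a : value S (tail_from n.+1 s) < value S (alpha S (s n)).
      by rewrite -(ltr_step S (s n)) aE below.
    (* The upper lexicographic bound relies on the lower condition: were the tail lexicographically
       larger than [alpha], [above_prev] would make its value larger too. *)
    have [eq|[//|gt]] := lex_total (tail_from n.+1 s) (alpha S (s n)).
      by move: lt_a; rewrite eq ltxx.
    by have := above_prev_lex S_regular (above_tail _) gt; rewrite ltNge ltW.
  + have [_ cE] := gammaP S_regular sn.
    have lt_c : value S (gamma S (s n)) < value S (tail_from n.+1 s).
      by rewrite -(ltr_step S (s n)) cE above.
    have [eq|[lt|//]] := lex_total (tail_from n.+1 s) (gamma S (s n)).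
      by move: lt_c; rewrite eq ltxx.
    by have := below_next_lex S_regular (below_tail _) lt; rewrite ltNge ltW.
- have below : below_next S s.
    apply: (lex_below_next (a := alpha S)) => // [j|n]; first exact: alphaP.
    by have [] := lex_s n.
  have above : above_prev S s.
    apply: (lex_above_prev (c := gamma S)) => // [j|n]; first exact: gammaP.
    by have [] := lex_s n.
  split=> // t t_x; have ts : value S t = value S s by rewrite [LHS]t_x.
  (* A lexicographically smaller [t] has a strictly smaller value by [above], a larger one a
     strictly larger value by [below]. *)
  have [//|[lt|lt]] := lex_total t s.
    by have := above_prev_lex S_regular above lt; rewrite ts ltxx.
  by have := below_next_lex S_regular below lt; rewrite ts ltxx.
Qed.
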